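(* Consider the ViSE model described in the context, with $n$ participants, $\ell$ egoists and $g=n-\ell$ group members ($1\le\ell\le n-1$), $\mu\in\mathbb{R}$, $\sigma>0$ and majority threshold $\alpha\in[0,1)$. Let $\delta=\ell/n$, $\gamma=\alpha+\delta-1$, $\beta=\ell/(n-\ell)$. Then the expected one-step capital increment of the society, as a function of the group's claims threshold $t\in\mathbb{R}$, reaches its maximum at $$t_0=\frac{\beta}{F_{\gamma n}-F_{\alpha n}}\Big(\mu^+(\mu,\sigma,\ell,\alpha n)-\mu^+(\mu,\sigma,\ell,\gamma n)\Big).$$
   Context: ViSE model (one voting step). A society consists of $n$ participants: $\ell$ ''egoists'' and $g=n-\ell$ ''group members'', $1\le\ell\le n-1$. Fix $\mu\in\mathbb{R}$, $\sigma>0$, a majority threshold $\alpha$ and a group claims threshold $t\in\mathbb{R}$. A proposal is a random vector $(\zeta_1,\dots,\zeta_n)$ of independent $N(\mu,\sigma^2)$ random variables, $\zeta_i$ being the proposed capital increment of participant $i$. Each egoist votes for the proposal iff his own component is strictly positive. All group members vote for the proposal iff the arithmetic mean of the group members' components is strictly greater than $t$; otherwise they all vote against. The proposal is accepted iff the number of votes for it is strictly greater than $\alpha n$. If accepted, each participant's capital increment equals his component; otherwise it is $0$. The expected one-step capital increment of the society is the expectation of the sum of all participants' increments (equivalently, up to the factor $n$, the expected increment of a uniformly randomly selected participant). $F$ denotes the standard normal distribution function. $p=F(\mu/\sigma)$, $q=1-p$, and for real $\xi$, $F_\xi=\sum_{x=\max(0,[\xi]+1)}^{\ell}\binom{\ell}{x}p^xq^{\ell-x}$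 ($[\xi]$ the integer part; empty sum $=0$), the probability that more than $\xi$ egoists vote for the proposal. For integer $\ell\ge1$ and real $\ell_0$, $\mu^+(\mu,\sigma,\ell,\ell_0)=\mathrm{M}\big(\xi_1\cdot\mathbf{1}\{\#\{i:\xi_i>0\}>\ell_0\}\big)$ where $\xi_1,\dots,\xi_\ell$ are i.i.d. $N(\mu,\sigma^2)$. *)

(* Defs.v *)
From HB Require Import structures.
From mathcomp Require Import all_boot all_order all_algebra.
From mathcomp Require Import all_classical all_reals all_analysis.
From mathcomp Require Import normal_distribution.
Set Implicit Arguments. Unset Strict Implicit. Unset Printing Implicit Defensive.
Import Order.TTheory GRing.Theory Num.Theory.
Local Open Scope classical_set_scope.
Local Open Scope ring_scope.

Section ViSE.
Context {R : realType} {d : measure_display} {T : measurableType d}.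

(* X_0, ..., X_(k-1) are mutually independent real random variables:
   product rule for the joint preimages of arbitrary Borel sets
   (taking B i = setT recovers every subfamily). *)
Definition mutually_independent (P : probability T R) (k : nat)
    (X : nat -> {RV P >-> R}) : Prop :=
  forall B : nat -> set R, (forall i, measurable (B i)) ->
    P (\bigcap_(i in [set i | (i < k)%N]) (X i @^-1` B i)) =
    (\prod_(i < k) P (X i @^-1` B i))%E.

Definition iid_normal (P : probability T R) (k : nat)
    (X : nat -> {RV P >-> R}) (m s : R) : Prop :=
  @mutually_independent P k X /\
  forall i, (i < k)%N -> @distribution _ _ _ _ _ P (X i) = normal_prob m s :> (set R -> \bar R).

Definition count_pos (k : nat) (x : nat -> R) : nat :=
  (\sum_(i < k) nat_of_bool (0 < x i)%R)%N.

(* mu^+(mu, sigma, l, l0) = M( xi_1 * 1{ #{i : xi_i > 0} > l0 } ),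
   computed on i.i.d. N(mu,sigma^2) variables xi_0 .. xi_(l-1) *)
Definition mu_plus (P : probability T R) (l : nat)
    (xi : nat -> {RV P >-> R}) (l0 : R) : \bar R :=
  'E_P[fun w => (xi 0%N w * (nat_of_bool (l0 < (count_pos l (fun i => xi i w))%:R))%:R)%R].

(* The ViSE society: participants 0..l-1 are egoists, l..n-1 group members,
   zeta i is the proposed increment of participant i. *)
Definition votes_for (n l : nat) (t : R) (zeta : nat -> R) : nat :=
  (count_pos l zeta +
   (if ((\sum_(l <= i < n) zeta i) / (n - l)%:R > t)%R then n - l else 0))%N.

Definition accepted (n l : nat) (alpha t : R) (zeta : nat -> R) : bool :=
  alpha * n%:R < (votes_for n l t zeta)%:R.

Definition society_increment (P : probability T R) (n l : nat)
    (zeta : nat -> {RV P >-> R}) (alpha t : R) : \bar R :=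
  'E_P[fun w => (\sum_(i < n) zeta i w) *
                (accepted n l alpha t (fun i => zeta i w))%:R].

End ViSE.
Arguments mutually_independent {R d T} P k X.
Arguments iid_normal {R d T} P k X m s.
Arguments mu_plus {R d T} P l xi l0.
Arguments society_increment {R d T} P n l zeta alpha t.

Definition Phi {R : realType} (x : R) : R := fine (normal_prob 0 1 `]-oo, x]).

Definition F_xi {R : realType} (mu sigma : R) (l : nat) (xi : R) : R :=
  let p := Phi (mu / sigma) in
  \sum_(x < l.+1 | (Order.max 0 (Num.floor xi + 1) <= (x : nat)%:Z)%R)
     'C(l, x)%:R * p ^+ x * (1 - p) ^+ (l - x).

(* Main.v *)
Require Import Defs.
From HB Require Import structures.
From mathcomp Require Import all_boot all_order all_algebra.
From mathcomp Require Import all_classical all_reals all_analysis.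
From mathcomp Require Import measurable_realfun normal_distribution.
From mathcomp Require Import ring lra zify.
Import Order.TTheory GRing.Theory Num.Theory.
Import numFieldNormedType.Exports.
Local Open Scope classical_set_scope.
Local Open Scope ring_scope.

(** Let c be the number of egoists with positive increment, S_E the sum of the
    egoists' increments, G the mean increment of the group and g = n - l. The
    proposal is accepted iff c > alpha n, or G > t and A holds, where A is the
    event gamma n < c <= alpha n in which the group's vote decides. As G is
    independent of the egoists, the part of the expected increment which depends
    on t is  E[S_E 1_A] P(G > t) + g P(A) E[G 1_{G > t}].  By exchangeability
    E[S_E 1_A] = l (mu^+(gamma n) - mu^+(alpha n)) = - g P(A) t0, so this part is
    g P(A) E[(G - t0) 1_{G > t}], and (G - t0) 1_{G > t} <= (G - t0) 1_{G > t0}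
    pointwise. If P(A) = 0 the increment does not depend on t. *)

(** * The normal distribution *)

(** The Radon-Nikodym derivative of the normal law and [normal_pdf] have the same integral over
    every measurable set, so they agree almost everywhere. *)
Lemma ge0_integral_normal_prob {R : realType} (m s : R) (f : R -> \bar R) :
  measurable_fun setT f -> (forall x, 0 <= f x)%E ->
  (\int[normal_prob m s]_x f x =
   \int[lebesgue_measure]_x (f x * (normal_pdf m s x)%:E))%E.
Proof.
move=> mf f0.
have dom := @normal_prob_dominates R m s.
rewrite -(Radon_Nikodym_SigmaFinite.change_of_variables dom f0 measurableT mf).
have fi := Radon_Nikodym_SigmaFinite.f_integrable dom.
apply: ae_eq_integral => //.
- by apply: emeasurable_funM => //; exact: measurable_int fi.
- by apply: emeasurable_funM => //; apply/measurable_EFinP; exact: measurable_normal_pdf.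
apply: ae_eqe_mul2l; apply: integral_ae_eq => //.
- by apply/measurable_EFinP; exact: measurable_normal_pdf.
- by move=> E _ mE; rewrite -Radon_Nikodym_SigmaFinite.f_integral.
Qed.

(* With y = 3 (x - m)^2 / (8 s^2), the two densities differ by a factor e^(-y)
   up to a constant, and |x - m| <= 1 + (x - m)^2 = 1 + (8 / 3) s^2 y
   <= (1 + (8 / 3) s^2) e^y. *)
Lemma normal_pdf_dominates_center {R : realType} (m s : R) : 0 < s ->
  exists C, forall x,
    `|x - m| * normal_pdf m s x <= C * normal_pdf m (2 * s) x.
Proof.
move=> s0; have s2 : 0 < 2 * s by rewrite mulr_gt0.
exists (normal_peak s / normal_peak (2 * s) * (1 + 8 / 3 * s ^+ 2)) => x.
have k0 : 0 < normal_peak s by rewrite normal_peak_gt0// gt_eqF.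
have k20 : 0 < normal_peak (2 * s) by rewrite normal_peak_gt0// gt_eqF.
rewrite !normal_pdfE ?gt_eqF//=  /normal_fun.
set u := x - m.
set a := (X in _ <= X).
have -> : a = normal_peak s *
    ((1 + 8 / 3 * s ^+ 2) * expR (- u ^+ 2 / ((2 * s) ^+ 2 *+ 2))).
  by rewrite /a; field; rewrite gt_eqF.
rewrite mulrCA ler_pM2l//.
have s0' : s != 0 by rewrite gt_eqF.
have -> : - u ^+ 2 / (s ^+ 2 *+ 2) =
    - u ^+ 2 / ((2 * s) ^+ 2 *+ 2) - 3 / 8 * (u ^+ 2 / s ^+ 2).
  by field.
rewrite expRD mulrCA [leRHS]mulrC ler_pM2l ?expR_gt0//.
rewrite expRN ler_pdivrMr ?expR_gt0//.
set y := 3 / 8 * _.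
have y0 : 0 <= y by rewrite mulr_ge0// divr_ge0 ?sqr_ge0.
have ey : 1 + y <= expR y by exact: expR_ge1Dx.
have uy : u ^+ 2 = 8 / 3 * s ^+ 2 * y by rewrite /y; field.
have c0 : 0 <= 8 / 3 * s ^+ 2 by rewrite mulr_ge0// sqr_ge0.
apply: (@le_trans _ _ ((1 + 8 / 3 * s ^+ 2) * (1 + y))); last first.
  by rewrite ler_pM2l// ltr_wpDr.
have : `|u| <= 1 + u ^+ 2.
  rewrite -[u ^+ 2]real_normK ?num_real//; have := normr_ge0 u.
  move: `|u| => v v0; nra.
move/le_trans; apply; rewrite uy; nra.
Qed.

(** The centred first moment is dominated by a multiple of the normal density with standard
    deviation [2 * s], which is integrable; the constant [m] is then added back. *)
Lemma integrable_normal_prob_id {R : realType} (m s : R) : 0 < s ->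
  (normal_prob m s).-integrable setT (fun x => x%:E).
Proof.
move=> s0; pose mu := @lebesgue_measure R.
have [C HC] := normal_pdf_dominates_center m s s0.
have I : (normal_prob m s).-integrable setT (EFin \o (fun x => x - m)).
  apply/integrableP; split.
    by apply/measurable_EFinP; exact: measurable_funB.
  rewrite ge0_integral_normal_prob//; last first.
    apply: measurableT_comp => //; apply/measurable_EFinP; exact: measurable_funB.
  have J : mu.-integrable setT (fun x => C%:E * (normal_pdf m (2 * s) x)%:E)%E.
    by apply: integrableZl => //; exact: integrable_normal_pdf.
  apply: (@le_lt_trans _ _ (\int[mu]_x `|C%:E * (normal_pdf m (2 * s) x)%:E|)%E);
    last by case/integrableP : J.
  apply: ge0_le_integral => //.
  - by move=> x _; rewrite mule_ge0// lee_fin normal_pdf_ge0.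
  - apply: emeasurable_funM; last first.
      by apply/measurable_EFinP; exact: measurable_normal_pdf.
    apply: measurableT_comp => //; apply/measurable_EFinP; exact: measurable_funB.
  - by apply: measurableT_comp => //; exact: measurable_int J.
  - move=> x _; apply: le_trans (lee_abs _).
    by rewrite /= -!EFinM lee_fin.
have := @integrableD _ _ _ _ setT measurableT _ _ I
  (finite_measure_integrable_cst (normal_prob m s) m measurableT).
by apply: eq_integrable => // x _; rewrite /= -EFinD subrK.
Qed.

(** The decreasing substitution x -> (m - x) / s carries the upper tail at 0 to the standard lower
    tail at m / s, and its factor 1 / s turns the standard density into that of mean [m] and
    deviation [s]. *)
Lemma normal_prob_gt0 {R : realType} (m s : R) : 0 < s ->
  normal_prob m s `]0, +oo[ = (Phi (m / s))%:E.
Proof.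
move=> s0; pose mu := @lebesgue_measure R.
have sN0 : s != 0 by rewrite gt_eqF.
pose F : R -> R := fun x => (m - x) / s.
have F0 : F 0 = m / s by rewrite /F subr0.
have dF x : is_derive (x : R) 1 F (- s^-1).
  rewrite /F; apply: is_derive_eq.
  by rewrite /GRing.scale/=; ring.
have F' : F^`()%classic = cst (- s^-1).
  by apply/funext => x; rewrite derive1E; apply: derive_val.
have cF : continuous F.
  by move=> x; apply: differentiable_continuous; exact/derivable1_diffP.
rewrite /Phi fineK; last by apply: fin_num_measure.
rewrite /normal_prob -F0.
rewrite decreasing_ge0_integration_by_substitutiony; first last.
- by move=> x _; exact: normal_pdf_ge0.
- apply: continuous_subspaceT => x; exact: continuous_normal_pdf.
- apply: gt0_cvgMlNy; rewrite ?invr_gt0//.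
  apply/cvgNry; rewrite (_ : - _ = (fun x => x - m)); first exact: cvg_addrr.
  by apply/funext => x; rewrite fctE opprB.
- by split => [x _|]; [|apply: cvg_at_right_filter; exact: cF].
- by rewrite F'; exact: is_cvg_cst.
- by rewrite F'; exact: is_cvg_cst.
- by rewrite F' => x _; exact: cvg_cst.
- by move=> x y _ _ xy; rewrite /F ltr_pM2r ?invr_gt0// ltrD2l ltrN2.
(* The substitution yields the half-line closed at 0; the endpoint is a null set. *)
rewrite -integral_itv_obnd_cbnd; last first.
  apply/measurable_EFinP/measurable_funTS/measurable_funM.
    by apply: measurableT_comp; [exact: measurable_normal_pdf|exact: continuous_measurable_fun].
  by rewrite F'; exact: measurable_funN.
apply: eq_integral => x _; congr EFin.
rewrite F' !fctE opprK !normal_pdfE ?oner_eq0// /normal_fun /normal_peak /F.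
rewrite subr0 expr1n mul1r -[s ^+ 2 * pi *+ 2]mulrnAr sqrtrM ?sqr_ge0// sqrtr_sqr gtr0_norm//.
have -> : - (x - m) ^+ 2 / (s ^+ 2 *+ 2) = - ((m - x) / s) ^+ 2 / (1 *+ 2) by field.
by rewrite invfM; ring.
Qed.

(** * Independence *)

(** Uniqueness of measures, used once for each side: for a fixed [A] in [G], the finite measures P(C
    & A) and P(A) P(C) of C agree on the pi-system [H], hence on the sigma-algebra it generates. *)
Lemma independent_g_sigma {R : realType} {d} {T : measurableType d}
    (P : probability T R) (G H : set (set T)) :
  G `<=` measurable -> H `<=` measurable -> setI_closed G -> setI_closed H ->
  G setT -> H setT ->
  (forall A B, G A -> H B -> P (A `&` B) = (P A * P B)%E) ->
  forall A B, <<s G >> A -> <<s H >> B -> P (A `&` B) = (P A * P B)%E.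
Proof.
have half (G' H' : set (set T)) : G' `<=` measurable -> H' `<=` measurable ->
    setI_closed H' -> H' setT ->
    (forall A B, G' A -> H' B -> P (A `&` B) = (P A * P B)%E) ->
    forall A B, G' A -> <<s H' >> B -> P (A `&` B) = (P A * P B)%E.
  move=> mG mH HI HT GH A B GA; have mA := mG _ GA.
  have fA : P A \is a fin_num by apply: fin_num_measure.
  have A0 : 0 <= fine (P A) by rewrite fine_ge0.
  pose m1 : {measure set T -> \bar R} := mrestr P mA.
  pose m2 : {measure set T -> \bar R} := mscale (NngNum A0) P.
  have m1E C : m1 C = P (C `&` A) by [].
  have m2E C : m2 C = (P A * P C)%E by rewrite /m2 /= /mscale /= fineK.
  move=> HB; rewrite setIC -m1E -m2E.
  apply: (g_sigma_algebra_measure_unique H' mH (fun=> setT)) => //.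
  - by rewrite bigcup_const.
  - by move=> C HC; rewrite m1E m2E setIC GH.
  - by move=> _; rewrite m1E setTI ltey_eq fA.
move=> mG mH GI HI GT HT GH A B GA HB.
rewrite setIC muleC.
(* The roles are now exchanged. In [half] the fixed set comes from any family of measurable sets, so
   it may range over all of [<<s H>>]. *)
apply: (half (<<s H >>) G) => //.
  by apply: smallest_sub => //; exact: sigma_algebra_measurable.
by move=> C D HC GD; rewrite setIC muleC; exact: (half G H).
Qed.

(** * Expectation of a product of two independent variables *)

Section independent_product.
Context {R : realType} {d} {T : measurableType d} (P : probability T R).
Context {U V : T -> R}.
Hypotheses (iU : P.-integrable setT (EFin \o U))
  (iV : P.-integrable setT (EFin \o V)).
Hypothesis UV : forall A B, measurable A -> measurable B ->
  P (U @^-1` A `&` V @^-1` B) = (P (U @^-1` A) * P (V @^-1` B))%E.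

Let mU : measurable_fun setT U.
Proof. by apply/measurable_EFinP; exact: measurable_int iU. Qed.

Let mV : measurable_fun setT V.
Proof. by apply/measurable_EFinP; exact: measurable_int iV. Qed.

Let W w := (U w, V w).

Let mW : measurable_fun setT W. Proof. exact: measurable_fun_pair. Qed.

Let dU : probability _ R := distribution P (mfun_Sub (mem_set mU)).
Let dV : probability _ R := distribution P (mfun_Sub (mem_set mV)).
Let dW : probability _ R := distribution P (mfun_Sub (mem_set mW)).

(** A product measure is determined by its values on rectangles, where independence gives the joint
    law. *)
Let dWE X : measurable X -> (dU \x dV)%E X = dW X.
Proof.
apply: product_measure_unique => A B mA mB.
by rewrite /dW /distribution/= /pushforward -UV.
Qed.

Let mulXY (z : R * R) : \bar R := (z.1 * z.2)%:E.

Let m_mulXY : measurable_fun setT mulXY.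
Proof. by apply/measurable_EFinP; apply: measurable_funM. Qed.

Let int_dU : dU.-integrable setT (fun x : R => x%:E).
Proof.
apply: (integrable_pushforward (phi := U)) => //.
by apply/measurable_EFinP.
Qed.

Let int_dV : dV.-integrable setT (fun x : R => x%:E).
Proof.
apply: (integrable_pushforward (phi := V)) => //.
by apply/measurable_EFinP.
Qed.

(** By Tonelli, the integral of |x y| is the product of the two absolute first moments, both
    finite. *)
Let int_mulXY : (dU \x dV)%E.-integrable setT mulXY.
Proof.
apply/integrable12ltyP => //.
under eq_integral => x _.
  under eq_integral => y _ do rewrite /mulXY EFinM abseM /=.
  rewrite ge0_integralZl//; last exact: measurableT_comp.
  over.
case/integrableP : int_dU => _ fU; case/integrableP : int_dV => _ fV.
rewrite ge0_integralZr//; [|exact: measurableT_comp|exact: integral_ge0].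
by rewrite lte_mul_pinfty// ?integral_ge0// ge0_fin_numE// integral_ge0.
Qed.

Lemma integrableM_independent : P.-integrable setT (EFin \o (fun w => U w * V w)).
Proof.
apply/integrableP; split; first by apply/measurable_EFinP/measurable_funM.
case/integrableP : int_mulXY => _.
rewrite (eq_measure_integral dW); last by move=> A mA _; exact: dWE.
by rewrite ge0_integral_distribution//; exact: measurableT_comp.
Qed.

(** Fubini for the product of the two marginal laws, after transport of the integral to the joint
    law. *)
Lemma RintegralM_independent :
  \int[P]_w (U w * V w) = \int[P]_w U w * \int[P]_w V w.
Proof.
rewrite /Rintegral.
transitivity (fine (\int[dW]_z mulXY z)%E).
  by rewrite integral_distribution//; exact: integrableM_independent.
rewrite (eq_measure_integral (dU \x dV)%E); last by move=> A mA _; rewrite /= dWE.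
rewrite -integral12_prod_meas1//.
transitivity (fine (\int[dU]_x (x%:E * \int[dV]_y y%:E))%E).
  congr fine; apply: eq_integral => x _.
  by rewrite -integralZl//; apply: eq_integral => y _; rewrite -EFinM.
have -> : (\int[dV]_y y%:E = \int[P]_w (V w)%:E)%E.
  by rewrite integral_distribution.
have fV : (\int[P]_w (V w)%:E)%E \is a fin_num by exact: integrable_fin_num.
rewrite -(fineK fV) integralZr// integral_distribution//=.
by rewrite fineM//; exact: integrable_fin_num.
Qed.

End independent_product.

Lemma integrableM_bool {R : realType} {d} {T : measurableType d}
    (P : probability T R) (f : T -> R) (b : T -> bool) :
  P.-integrable setT (EFin \o f) ->
  measurable_fun setT (fun w => (b w)%:R : R) ->
  P.-integrable setT (EFin \o (fun w => f w * (b w)%:R)).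
Proof.
move=> fi mb; have mf : measurable_fun setT f.
  by apply/measurable_EFinP; exact: measurable_int fi.
apply: le_integrable fi => //; first by apply/measurable_EFinP/measurable_funM.
move=> w _; rewrite /= lee_fin normrM ler_piMr// ger0_norm//.
by case: (b w).
Qed.

Lemma integrable_bool {R : realType} {d} {T : measurableType d}
    (P : probability T R) (b : T -> bool) :
  measurable_fun setT (fun w => (b w)%:R : R) ->
  P.-integrable setT (EFin \o (fun w => (b w)%:R : R)).
Proof.
move=> mb.
have := integrableM_bool P (cst 1) b (finite_measure_integrable_cst P 1 measurableT) mb.
by apply: eq_integrable => // w _; rewrite /= mul1r.
Qed.

(* events determined by the [X i] with [i < k] in the block [K]; they form a
   pi-system generating the sigma-algebra of the block *)
Definition cylinder {R : realType} {T : Type} (X : nat -> T -> R) (k : nat)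
    (K : pred nat) : set (set T) :=
  [set A | exists2 B : nat -> set R, forall i, measurable (B i) &
     A = \bigcap_(i in [set i | (i < k)%N && K i]) X i @^-1` B i].

(** The source type is replaced by a copy of [T] carrying the sigma-algebra of the block, so that
    the general closure lemmas for measurable functions apply to it. *)
Definition block_measurable {R : realType} {d} {T : measurableType d}
    (X : nat -> T -> R) (k : nat) (K : pred nat) (f : T -> R) :=
  @measurable_fun _ _ (g_sigma_algebraType (cylinder X k K)) R setT f.

(** * Independence of complementary blocks of variables *)

Section blocks.
Context {R : realType} {d} {T : measurableType d} (P : probability T R).
Context (X : nat -> {RV P >-> R}) (k : nat).

Let cyl K := cylinder (fun i => X i : T -> R) k K.

Lemma cylinder_measurable K : cyl K `<=` measurable.
Proof.
move=> _ [B mB ->]; apply: bigcap_measurableType => i _.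
by rewrite -[X in measurable X]setTI; exact: measurable_funPT.
Qed.

Lemma cylinder_setI K : setI_closed (cyl K).
Proof.
move=> _ _ [B mB ->] [C mC ->]; exists (fun i => B i `&` C i).
  by move=> i; exact: measurableI.
by rewrite -bigcapI; apply: eq_bigcapr => i _; rewrite preimage_setI.
Qed.

Lemma cylinder_setT K : cyl K setT.
Proof.
exists (fun=> setT) => //; by apply/seteqP; split.
Qed.

Lemma cylinder_independent K A B : mutually_independent P k X ->
  cyl K A -> cyl (predC K) B -> P (A `&` B) = (P A * P B)%E.
Proof.
move=> ind [A' mA ->] [B' mB ->].
(* Indices outside the block receive the full set. All three events then become intersections over
   the same [k] indices, and the product rule applies to each. *)
have E (Q : pred nat) (C : nat -> set R) :
    \bigcap_(i in [set i | (i < k)%N && Q i]) X i @^-1` C i =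
    \bigcap_(i in [set i | (i < k)%N]) X i @^-1` (if Q i then C i else setT).
  apply/seteqP; split => w H i /=.
    by move=> ik; case: ifPn => // Qi; apply: H => /=; rewrite ik.
  by move=> /andP[ik Qi]; have := H i ik; rewrite Qi.
have -> : \bigcap_(i in [set i | (i < k)%N && K i]) X i @^-1` A' i `&`
    \bigcap_(i in [set i | (i < k)%N && predC K i]) X i @^-1` B' i =
    \bigcap_(i in [set i | (i < k)%N]) X i @^-1` (if K i then A' i else B' i).
  rewrite !E -bigcapI; apply: eq_bigcapr => i _ /=.
  by case: (K i); rewrite /= preimage_setT ?setTI ?setIT.
rewrite !E !ind; do ?by move=> i; case: ifP.
rewrite -big_split; apply: eq_bigr => i _ /=.
by case: (K i); rewrite /= preimage_setT probability_setT ?mule1 ?mul1e.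
Qed.

Lemma block_measurable_measurable K (f : T -> R) :
  block_measurable (fun i => X i : T -> R) k K f -> measurable_fun setT f.
Proof.
move=> bf mT B mB; have := bf measurableT B mB.
apply: smallest_sub; first exact: sigma_algebra_measurable.
exact: cylinder_measurable.
Qed.

Lemma block_measurable_id (K : pred nat) i : (i < k)%N -> K i ->
  block_measurable (fun i => X i : T -> R) k K (X i).
Proof.
move=> ik Ki _ B mB; rewrite setTI; apply: sub_gen_smallest.
exists (fun j => if j == i then B else setT) => [j|]; first by case: ifP.
apply/seteqP; split => w /=.
  by move=> Bw j _; case: eqP => [->|].
by move=> /(_ i); rewrite /= eqxx; apply; rewrite ik.
Qed.

Lemma block_independent K (f g : T -> R) A B : mutually_independent P k X ->
  block_measurable (fun i => X i : T -> R) k K f ->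
  block_measurable (fun i => X i : T -> R) k (predC K) g ->
  measurable A -> measurable B ->
  P (f @^-1` A `&` g @^-1` B) = (P (f @^-1` A) * P (g @^-1` B))%E.
Proof.
move=> ind bf bg mA mB.
apply: (independent_g_sigma P (cyl K) (cyl (predC K))).
- exact: cylinder_measurable.
- exact: cylinder_measurable.
- exact: cylinder_setI.
- exact: cylinder_setI.
- exact: cylinder_setT.
- exact: cylinder_setT.
- by move=> C D; exact: cylinder_independent.
- by have := bf measurableT A mA; rewrite setTI.
- by have := bg measurableT B mB; rewrite setTI.
Qed.

Lemma block_RintegralM K (f g : T -> R) : mutually_independent P k X ->
  block_measurable (fun i => X i : T -> R) k K f ->
  block_measurable (fun i => X i : T -> R) k (predC K) g ->
  P.-integrable setT (EFin \o f) -> P.-integrable setT (EFin \o g) ->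
  \int[P]_w (f w * g w) = \int[P]_w f w * \int[P]_w g w.
Proof.
move=> ind bf bg fi gi; apply: RintegralM_independent => // A B mA mB.
exact: (block_independent K).
Qed.

End blocks.

(** * Binomial means *)

(** The probability that a binomial variable with parameters [m] and [p] satisfies [phi]. *)
Definition binom_mean {R : realType} (p : R) (m : nat) (phi : pred nat) : R :=
  \sum_(x < m.+1 | phi x) 'C(m, x)%:R * p ^+ x * (1 - p) ^+ (m - x).

Lemma binom_mean0 {R : realType} (p : R) phi : binom_mean p 0 phi = (phi 0%N)%:R.
Proof.
rewrite /binom_mean big_mkcond big_ord_recl big_ord0 /= addr0 bin0 !expr0 !mulr1.
by case: (phi 0%N).
Qed.

(** Conditioning on one trial, which is Pascal's rule on the coefficients: a success shifts the
    count by one. *)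
Lemma binom_meanS {R : realType} (p : R) m phi :
  binom_mean p m.+1 phi =
  p * binom_mean p m (phi \o succn) + (1 - p) * binom_mean p m phi.
Proof.
have E n psi : binom_mean p n psi =
    \sum_(x < n.+1) (psi x)%:R * ('C(n, x)%:R * p ^+ x * (1 - p) ^+ (n - x)).
  rewrite /binom_mean big_mkcond; apply: eq_bigr => x _.
  by case: (psi x); rewrite ?mul1r ?mul0r.
rewrite !E big_ord_recl /=.
under eq_bigr => i _ do rewrite binS natrD mulrDl mulrDl mulrDr subSS.
rewrite big_split /= addrA addrC; congr (_ + _).
  rewrite mulr_sumr; apply: eq_bigr => i _ /=.
  by rewrite exprS; ring.
(* Among the terms with coefficient C(m, i + 1) the last one vanishes; the others, with the term for
   x = 0 set apart before, form the failure part. *)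
rewrite [in LHS]big_ord_recr /= ['C(m, m.+1)]bin_small// !mul0r mulr0 addr0.
rewrite [in RHS]big_ord_recl mulrDr mulr_sumr; congr (_ + _).
  by rewrite !bin0 !subn0 exprS; ring.
apply: eq_bigr => i _ /=; rewrite /bump /= add1n.
rewrite -(subnSK (ltn_ord i)) !exprS; ring.
Qed.

Section positive_count.
Context {R : realType} {d} {T : measurableType d} (P : probability T R).
Context (X : nat -> {RV P >-> R}) (k : nat).

(** Counting over an arbitrary list of indices lets any chosen variable be split off, which an
    initial segment does not. *)
Definition pos_count (J : seq nat) (w : T) : nat :=
  (\sum_(j <- J) nat_of_bool (0 < X j w)%R)%N.

(** Splitting on the sign of [X i] separates the factor depending on [X i] from the count over [J];
    measurability and means follow from it by induction on the list. *)
Lemma pos_count_cons i J (phi : pred nat) w :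
  (phi (pos_count (i :: J) w))%:R =
  \1_`]0, +oo[ (X i w) * (phi (pos_count J w).+1)%:R +
  \1_`]-oo, 0] (X i w) * (phi (pos_count J w))%:R :> R.
Proof.
rewrite /pos_count big_cons !indicE !mem_setE !in_itv/= andbT ltNge.
by case: (X i w <= 0); rewrite /= ?mul1r ?mul0r ?addr0 ?add0r ?add1n ?add0n.
Qed.

Lemma block_measurable_pos_count K J (phi : pred nat) :
  all (fun j => (j < k)%N && K j) J ->
  block_measurable (fun i => X i : T -> R) k K (fun w => (phi (pos_count J w))%:R).
Proof.
elim: J phi => [|i J IH] phi /=.
  move=> _; rewrite (_ : (fun _ => _) = cst (phi 0%N)%:R); first exact: measurable_cst.
  by apply/funext => w; rewrite /pos_count big_nil.
move=> /andP[/andP[ik Ki] aJ].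
rewrite /block_measurable (funext (pos_count_cons i J phi)).
have bX := block_measurable_id P X k K i ik Ki.
apply: measurable_funD; apply: measurable_funM.
- exact: measurableT_comp bX.
- exact: (IH (phi \o succn)).
- exact: measurableT_comp bX.
- exact: IH.
Qed.

Lemma measurable_pos_count J (phi : pred nat) :
  measurable_fun setT (fun w => (phi (pos_count J w))%:R : R).
Proof.
elim: J phi => [|i J IH] phi /=.
  rewrite (_ : (fun _ => _) = cst (phi 0%N)%:R); first exact: measurable_cst.
  by apply/funext => w; rewrite /pos_count big_nil.
rewrite (funext (pos_count_cons i J phi)).
apply: measurable_funD; apply: measurable_funM.
- exact: measurableT_comp.
- exact: (IH (phi \o succn)).
- exact: measurableT_comp.
- exact: IH.
Qed.

(** As [i] is not in [J], the count is measurable for the block complementary to the single index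
    [i]. *)
Lemma RintegralM_pos_count (f : R -> R) i J (phi : pred nat) :
  mutually_independent P k X -> measurable_fun setT f ->
  P.-integrable setT (EFin \o (f \o X i)) ->
  (i < k)%N -> all (fun j => (j < k)%N) J -> i \notin J ->
  \int[P]_w (f (X i w) * (phi (pos_count J w))%:R) =
  \int[P]_w f (X i w) * \int[P]_w (phi (pos_count J w))%:R.
Proof.
move=> ind mf fi ik aJ iJ.
apply: (block_RintegralM P X k (pred1 i)) => //.
- apply: (measurableT_comp mf).
  exact: (block_measurable_id P X k (pred1 i) i ik (eqxx i)).
- apply: block_measurable_pos_count; apply/allP => j jJ /=.
  by rewrite (allP aJ j jJ) /=; apply: contraNneq iJ => <-.
- exact: integrable_bool (measurable_pos_count J phi).
Qed.

End positive_count.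

(** * The number of positive i.i.d. normal variables *)

Section iid_normal_count.
Context {R : realType} {d} {T : measurableType d} (P : probability T R).
Context (X : nat -> {RV P >-> R}) (k : nat) (m s : R).
Hypotheses (s0 : 0 < s) (iid : iid_normal P k X m s).

(* [R] and [measurableTypeR R] have the same measurable sets but different
   displays, so integrals over the two types are not convertible. *)
Let Y i : T -> measurableTypeR R := X i.

Let mY i : measurable_fun setT (Y i).
Proof. exact: (measurable_funPT (X i)). Qed.

Let pushforwardE i : (i < k)%N -> pushforward P (Y i) = normal_prob m s.
Proof. by move=> ik; rewrite -(iid.2 i ik). Qed.

Lemma normal_integrable (f : R -> R) i : (i < k)%N -> measurable_fun setT f ->
  (normal_prob m s).-integrable setT (EFin \o f) ->
  P.-integrable setT (EFin \o (f \o X i)).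
Proof.
move=> ik mf /integrableP[mf' fi].
apply/integrableP; split; first by apply/measurable_EFinP; exact: measurableT_comp.
rewrite -(pushforwardE i ik) ge0_integral_pushforward// in fi.
exact: measurableT_comp.
Qed.

Lemma normal_Rintegral (f : R -> R) i : (i < k)%N -> measurable_fun setT f ->
  (normal_prob m s).-integrable setT (EFin \o f) ->
  \int[P]_w f (X i w) = \int[normal_prob m s]_x f x.
Proof.
move=> ik mf fi; have fX := normal_integrable f i ik mf fi.
have := integral_pushforward (mY i) (measurable_int _ fi) fX measurableT.
by rewrite pushforwardE// => fE; congr fine; exact: esym fE.
Qed.

Lemma normal_integrable_id i : (i < k)%N -> P.-integrable setT (EFin \o X i).
Proof.
move=> ik; apply: (normal_integrable id i ik) => //.
exact: integrable_normal_prob_id.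
Qed.

Let p := Phi (m / s).

Lemma Rintegral_indic_pos i : (i < k)%N ->
  \int[P]_w \1_`]0, +oo[ (X i w) = p.
Proof.
move=> ik; rewrite normal_Rintegral//; last exact: integrable_indic.
rewrite /Rintegral integral_indic// setIT.
by transitivity (fine (Phi (m / s))%:E) => //; rewrite -normal_prob_gt0.
Qed.

Lemma Rintegral_indic_nonpos i : (i < k)%N ->
  \int[P]_w \1_`]-oo, 0] (X i w) = 1 - p.
Proof.
move=> ik; rewrite normal_Rintegral//; last exact: integrable_indic.
rewrite /Rintegral integral_indic// setIT.
transitivity (fine (1 - normal_prob m s `]0%R, +oo[)%E); last by rewrite normal_prob_gt0.
by rewrite -(probability_setC (normal_prob m s))// setCitvr.
Qed.

(** Induction on the list: splitting on the sign of the head reproduces the recursion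
    [binom_meanS]. *)
Lemma Rintegral_pos_count J (phi : pred nat) : all (fun j => (j < k)%N) J -> uniq J ->
  \int[P]_w (phi (pos_count P X J w))%:R = binom_mean p (size J) phi.
Proof.
have [ind _] := iid.
elim: J phi => [|i J IH] phi /=.
  move=> _ _; rewrite binom_mean0.
  transitivity (\int[P]_(w in setT) (phi 0%N)%:R : R).
    by apply: eq_Rintegral => w _; rewrite /pos_count big_nil.
  by rewrite Rintegral_cst// [X in fine X]probability_setT mulr1.
move=> /andP[ik aJ] /andP[iJ uJ].
rewrite (funext (pos_count_cons P X i J phi)) binom_meanS.
have iI (A : set R) : measurable A -> P.-integrable setT (EFin \o (\1_A \o X i)).
  move=> mA; apply: normal_integrable => //; exact: integrable_indic.
rewrite RintegralD//; first last.
- apply: (integrableM_bool P (\1_`]-oo, 0] \o X i) (fun w => phi _)); first exact: iI.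
  exact: (measurable_pos_count P X J phi).
- apply: (integrableM_bool P (\1_`]0, +oo[ \o X i) (fun w => phi _)); first exact: iI.
  exact: (measurable_pos_count P X J (phi \o succn)).
rewrite (RintegralM_pos_count P X k \1_`]0, +oo[ i J (phi \o succn))//; last exact: iI.
rewrite (RintegralM_pos_count P X k \1_`]-oo, 0] i J phi)//; last exact: iI.
by rewrite Rintegral_indic_pos// Rintegral_indic_nonpos// !IH.
Qed.

(* mean of [x i * phi (number of positive x j)] over [J.+1] i.i.d. variables *)
Definition normal_pos_count_mean (J : nat) (phi : pred nat) : R :=
  \int[normal_prob m s]_x (x * \1_`]0, +oo[ x) * binom_mean p J (phi \o succn) +
  \int[normal_prob m s]_x (x * \1_`]-oo, 0] x) * binom_mean p J phi.

(** On each sign of [X i] the count over [J] is independent of [X i] and binomial. The value depends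
    on [i] and [J] only through the size of [J], which is the exchangeability used later. *)
Lemma RintegralM_pos_count_cons i J (phi : pred nat) :
  all (fun j => (j < k)%N) (i :: J) -> uniq (i :: J) ->
  \int[P]_w (X i w * (phi (pos_count P X (i :: J) w))%:R) =
  normal_pos_count_mean (size J) phi.
Proof.
have [ind _] := iid.
move=> /= /andP[ik aJ] /andP[iJ uJ].
have iI (A : set R) : measurable A ->
    (normal_prob m s).-integrable setT (EFin \o (fun x => x * \1_A x)).
  move=> mA; exact: (integrableM_bool (normal_prob m s) id (mem A)
    (integrable_normal_prob_id m s s0) (measurable_indic mA)).
have mI (A : set R) : measurable A -> measurable_fun setT (fun x : R => x * \1_A x).
  by move=> mA; apply: measurable_funM => //; exact: measurable_indic.
have iX (A : set R) : measurable A ->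
    P.-integrable setT (EFin \o ((fun x => x * \1_A x) \o X i)).
  by move=> mA; apply: normal_integrable => //; [exact: mI|exact: iI].
have -> : (fun w => X i w * (phi (pos_count P X (i :: J) w))%:R) =
   (fun w => (X i w * \1_`]0, +oo[ (X i w)) * ((phi \o succn) (pos_count P X J w))%:R +
     (X i w * \1_`]-oo, 0] (X i w)) * (phi (pos_count P X J w))%:R).
  by apply/funext => w; rewrite (pos_count_cons P X i J phi); ring.
rewrite RintegralD//; first last.
- apply: (integrableM_bool P ((fun x => x * \1_`]-oo, 0] x) \o X i) (fun w => phi _)); first exact: iX.
  exact: (measurable_pos_count P X J phi).
- apply: (integrableM_bool P ((fun x => x * \1_`]0, +oo[ x) \o X i) (fun w => phi _)).
    exact: iX.
  exact: (measurable_pos_count P X J (phi \o succn)).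
rewrite (RintegralM_pos_count P X k (fun x => x * \1_`]0, +oo[ x) i J (phi \o succn))//;
  [|exact: mI|exact: iX].
rewrite (RintegralM_pos_count P X k (fun x => x * \1_`]-oo, 0] x) i J phi)//;
  [|exact: mI|exact: iX].
rewrite !Rintegral_pos_count//.
by congr (_ * _ + _ * _); apply: normal_Rintegral => //; (exact: mI || exact: iI).
Qed.

Lemma count_pos_iota l w : count_pos l (fun i => X i w) = pos_count P X (iota 0 l) w.
Proof. by rewrite /count_pos /pos_count -[l in iota 0 l]subn0 -/(index_iota 0 l) big_mkord. Qed.

Lemma integrableM_count_pos i l (phi : pred nat) : (i < k)%N ->
  P.-integrable setT
    (EFin \o (fun w => X i w * (phi (count_pos l (fun i => X i w)))%:R)).
Proof.
move=> ik; apply: integrableM_bool; first exact: normal_integrable_id.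
under eq_fun do rewrite count_pos_iota.
exact: measurable_pos_count.
Qed.

Lemma Rintegral_count_pos l (phi : pred nat) : (l <= k)%N ->
  \int[P]_w (phi (count_pos l (fun i => X i w)))%:R = binom_mean p l phi.
Proof.
move=> lk; under eq_Rintegral do rewrite count_pos_iota.
rewrite Rintegral_pos_count ?size_iota ?iota_uniq//.
by apply/allP => j; rewrite mem_iota => /leq_trans; apply.
Qed.

(** The count is invariant under permutation, so [i] can be moved to the head of the list; the value
    is therefore the same for all [i]. *)
Lemma RintegralM_count_pos i l (phi : pred nat) : (i < l)%N -> (l <= k)%N ->
  \int[P]_w (X i w * (phi (count_pos l (fun i => X i w)))%:R) =
  normal_pos_count_mean l.-1 phi.
Proof.
move=> il lk.
have iI : i \in iota 0 l by rewrite mem_iota.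
have pI := perm_to_rem iI.
under eq_Rintegral => w _ do rewrite count_pos_iota /pos_count (perm_big _ pI).
rewrite RintegralM_pos_count_cons ?size_rem ?size_iota//.
  rewrite -(perm_all _ pI); apply/allP => j.
  by rewrite mem_iota => /leq_trans; apply.
by rewrite -(perm_uniq pI) iota_uniq.
Qed.

End iid_normal_count.

(** For a natural number x, floor(xi) + 1 <= x amounts to xi < x. *)
Lemma F_xiE {R : realType} (mu sigma : R) l (xi : R) :
  F_xi mu sigma l xi = binom_mean (Phi (mu / sigma)) l (fun x => xi < x%:R).
Proof.
rewrite /F_xi /binom_mean; apply: eq_bigl => x.
by rewrite ge_max lezD1 floor_lt_int.
Qed.

(** * The expected increment of the society *)

(** Turns the difference of the two values of [F_xi] into the probability that the group's vote
    decides. *)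
Lemma binom_mean_diff {R : realType} (p : R) k (phi psi : pred nat) :
  (forall x, psi x -> phi x) ->
  binom_mean p k phi - binom_mean p k psi =
  binom_mean p k (fun x => phi x && ~~ psi x).
Proof.
move=> sub; rewrite /binom_mean (bigID (fun x : 'I_k.+1 => psi x)) /= addrAC.
rewrite (eq_bigl (fun x : 'I_k.+1 => psi x)) ?subrr ?add0r// => x.
by rewrite andb_idl//; exact: sub.
Qed.

Lemma normal_pos_count_mean_diff {R : realType} (m s : R) k (phi psi : pred nat) :
  (forall x, psi x -> phi x) ->
  normal_pos_count_mean m s k phi - normal_pos_count_mean m s k psi =
  normal_pos_count_mean m s k (fun x => phi x && ~~ psi x).
Proof.
move=> sub; rewrite /normal_pos_count_mean.
rewrite -(binom_mean_diff _ _ _ _ sub).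
rewrite -(binom_mean_diff _ _ (phi \o succn) (psi \o succn)); last by move=> x; exact: sub.
by ring.
Qed.

(** * Integrals of finite sums and over null events *)

Section Rintegral_extra.
Context {R : realType} {d} {T : measurableType d} (P : probability T R).

Lemma integrable_Rsum (J : seq nat) (f : nat -> T -> R) :
  {in J, forall i, P.-integrable setT (EFin \o f i)} ->
  P.-integrable setT (EFin \o (fun w => \sum_(i <- J) f i w)).
Proof.
elim: J => [|i J IH] fi.
  by under [X in EFin \o X]eq_fun do rewrite big_nil; exact: integrable0.
under [X in EFin \o X]eq_fun do rewrite big_cons.
have IJ := IH (fun j jJ => fi j (mem_behead (s := i :: J) jJ)).
by have := integrableD measurableT (fi i (mem_head i J)) IJ; exact: eq_integrable.
Qed.

Lemma Rintegral_sum (J : seq nat) (f : nat -> T -> R) :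
  {in J, forall i, P.-integrable setT (EFin \o f i)} ->
  \int[P]_w (\sum_(i <- J) f i w) = \sum_(i <- J) \int[P]_w f i w.
Proof.
elim: J => [|i J IH] fi.
  by under eq_Rintegral do rewrite big_nil; rewrite big_nil Rintegral_cst// mul0r.
have fJ : {in J, forall j, P.-integrable setT (EFin \o f j)}.
  by move=> j jJ; apply: fi; rewrite inE jJ orbT.
under eq_Rintegral do rewrite big_cons.
rewrite RintegralD//= ?big_cons ?IH//; first exact/fi/mem_head.
exact: integrable_Rsum.
Qed.

(** The event where [b] holds is a null set. This serves the case where the group's vote decides
    with probability zero. *)
Lemma Rintegral_bool_eq0 (f : T -> R) (b : T -> bool) :
  P.-integrable setT (EFin \o f) ->
  measurable_fun setT (fun w => (b w)%:R : R) ->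
  \int[P]_w (b w)%:R = 0 -> \int[P]_w (f w * (b w)%:R) = 0.
Proof.
move=> fi mb b0; pose A := [set w | b w].
have bA w : (b w)%:R = \1_A w :> R by rewrite indicE; congr (nat_of_bool _)%:R; apply/idP/idP; rewrite inE.
have mA : measurable A.
  have := mb measurableT [set 1] (measurable_set1 _); rewrite setTI.
  congr (measurable _); apply/seteqP; split => w /=; rewrite /A /=.
    by case: (b w) => // /eqP; rewrite eq_sym oner_eq0.
  by move=> ->.
have PA : P A = 0%E.
  rewrite -[LHS]fineK ?fin_num_measure//; congr EFin; rewrite -[RHS]b0.
  rewrite /Rintegral; under eq_integral do rewrite bA.
  by rewrite integral_indic// setIT.
have fAE : (fun w => f w * (b w)%:R) = f \_ A.
  apply/funext => w; rewrite patchE bA indicE.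
  by case: (w \in A); rewrite ?mulr1 ?mulr0.
rewrite fAE -Rintegral_mkcond /Rintegral (null_set_integral mA)//.
by apply: measurable_funTS; exact: measurable_int fi.
Qed.

End Rintegral_extra.

(** The right-hand side depends only on the parameters of the law, so values of mu^+ computed on one
    probability space can be compared with means of egoists living on another. *)
Lemma mu_plusE {R : realType} {d} {T : measurableType d} (P : probability T R)
    (X : nat -> {RV P >-> R}) l (m s l0 : R) :
  0 < s -> (0 < l)%N -> iid_normal P l X m s ->
  fine (mu_plus P l X l0) = normal_pos_count_mean m s l.-1 (fun x => l0 < x%:R).
Proof.
move=> s0 l_gt0 iid.
rewrite /mu_plus unlock.
exact: (RintegralM_count_pos P X l m s s0 iid 0%N l (fun x => l0 < x%:R)).
Qed.

(** * Decomposition of the increment and choice of the threshold *)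

Section society.
Context {R : realType} {d} {T : measurableType d} (P : probability T R).
Context (n l : nat) (m s alpha : R) (X : nat -> {RV P >-> R}).
Hypotheses (s0 : 0 < s) (ln : (l < n)%N) (iid : iid_normal P n X m s).

Let c w := count_pos l (fun i => X i w).
Let G w := (\sum_(l <= i < n) X i w) / (n - l)%:R.
Let passes : pred nat := fun x => alpha * n%:R < x%:R.
(* the numbers of egoist votes for which the vote of the group is decisive *)
Let pivotal : pred nat := fun x =>
  (alpha * n%:R - (n - l)%:R < x%:R) && ~~ passes x.

Let iX i : (i < n)%N -> P.-integrable setT (EFin \o X i).
Proof. exact: (normal_integrable_id P X n m s s0 iid). Qed.

Let mc (phi : pred nat) : measurable_fun setT (fun w => (phi (c w))%:R : R).
Proof.
rewrite /c; under eq_fun do rewrite count_pos_iota.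
exact: measurable_pos_count.
Qed.

Let iG : P.-integrable setT (EFin \o G).
Proof.
have := integrable_Rsum P (index_iota l n) (fun i => X i : T -> R).
move=> /(_ _)/(@integrableZr _ _ _ _ setT measurableT (n - l)%:R^-1); apply.
by move=> i; rewrite mem_index_iota => /andP[_]; exact: iX.
Qed.

Definition egoist_mean := \int[P]_w ((\sum_(i < l) X i w) * (pivotal (c w))%:R).

Definition pivotal_prob := \int[P]_w (pivotal (c w))%:R.

Lemma acceptedE t w :
  (accepted n l alpha t (fun i => X i w))%:R =
  (passes (c w))%:R + (pivotal (c w))%:R * \1_`]t, +oo[ (G w) :> R.
Proof.
rewrite /accepted /votes_for -/(c w) -/(G w) indicE mem_setE in_itv/= andbT.
rewrite /pivotal /passes natrD.
(* The group's votes are nonnegative in number, so a proposal carried by the egoists alone still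
   passes when they are added. *)
have g0 : 0 <= (n - l)%:R :> R by [].
case: (t < G w); rewrite ?mulr1 ?mulr0 ?addr0// -ltrBlDr.
case: ltP => h1; case: ltP => h2; rewrite ?addr0 ?add0r//=.
by exfalso; move: h1 h2; lra.
Qed.

Let K : pred nat := fun i => (i < l)%N.
Let bl := block_measurable (fun i => X i : T -> R) n.

Let bsum (K' : pred nat) J : {in J, forall i, (i < n)%N && K' i} ->
  bl K' (fun w => \sum_(i <- J) X i w).
Proof.
move=> JK; elim: J JK => [|i J IH] JK.
  have -> : (fun w => \sum_(i <- [::]) X i w) = cst 0.
    by apply/funext => w; rewrite big_nil.
  exact: measurable_cst.
have -> : (fun w => \sum_(j <- i :: J) X j w) = (fun w => X i w + \sum_(j <- J) X j w).
  by apply/funext => w; rewrite big_cons.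
apply: measurable_funD; last by apply: IH => j jJ; apply: JK; rewrite inE jJ orbT.
by apply: block_measurable_id; have /andP[] := JK i (mem_head i J).
Qed.

Let bpivotal : bl K (fun w => (pivotal (c w))%:R).
Proof.
have -> : (fun w => (pivotal (c w))%:R : R) =
    (fun w => (pivotal (pos_count P X (iota 0 l) w))%:R).
  by apply/funext => w; rewrite -count_pos_iota.
apply: block_measurable_pos_count; apply/allP => i; rewrite mem_iota add0n /= => il.
by rewrite /K il (ltn_trans il ln).
Qed.

Let begoist : bl K (fun w => (\sum_(i < l) X i w) * (pivotal (c w))%:R).
Proof.
apply: measurable_funM; last exact: bpivotal.
have -> : (fun w => \sum_(i < l) X i w) = (fun w => \sum_(i <- index_iota 0 l) X i w).
  by apply/funext => w; rewrite big_mkord.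
apply: bsum => i; rewrite mem_index_iota /= => il.
by rewrite /K il (ltn_trans il ln).
Qed.

Let bG : bl (predC K) G.
Proof.
apply: measurable_funM; last exact: measurable_cst.
apply: bsum => i; rewrite mem_index_iota => /andP[li ->].
by rewrite /= /K -leqNgt.
Qed.

Let bG1 t : bl (predC K) (fun w => \1_`]t, +oo[ (G w)).
Proof. by apply: measurableT_comp bG. Qed.

Let mG1 t : measurable_fun setT (fun w => \1_`]t, +oo[ (G w) : R).
Proof. exact: block_measurable_measurable (bG1 t). Qed.

Let iG1 t : P.-integrable setT (EFin \o (fun w => \1_`]t, +oo[ (G w))).
Proof. exact: (integrable_bool P (fun w => G w \in `]t, +oo[%classic) (mG1 t)). Qed.

Let iGG1 t : P.-integrable setT (EFin \o (fun w => G w * \1_`]t, +oo[ (G w))).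
Proof. exact: (integrableM_bool P G (fun w => G w \in `]t, +oo[%classic) iG (mG1 t)). Qed.

Let isum k : (k <= n)%N -> P.-integrable setT (EFin \o (fun w => \sum_(i < k) X i w)).
Proof.
move=> kn; under [X in EFin \o X]eq_fun do rewrite -(big_mkord xpredT (fun i => X i _)).
apply: integrable_Rsum => i; rewrite mem_index_iota /= => ik.
exact/iX/(leq_trans ik).
Qed.

(** By [acceptedE] the mean splits into a part free of [t] and two means of products of a function
    of the egoists with a function of the group; block independence factors the latter two. *)
Lemma society_incrementE t : society_increment P n l X alpha t =
  (\int[P]_w ((\sum_(i < n) X i w) * (passes (c w))%:R) +
   egoist_mean * (\int[P]_w \1_`]t, +oo[ (G w)) +
   (n - l)%:R * (pivotal_prob * \int[P]_w (G w * \1_`]t, +oo[ (G w))))%:E.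
Proof.
have ind := iid.1.
have i1 : P.-integrable setT
    (EFin \o (fun w => (\sum_(i < n) X i w) * (passes (c w))%:R)).
  by apply: integrableM_bool; [exact: isum|exact: mc].
have iE : P.-integrable setT
    (EFin \o (fun w => (\sum_(i < l) X i w) * (pivotal (c w))%:R)).
  by apply: integrableM_bool; [exact/isum/ltnW|exact: mc].
have ip : P.-integrable setT (EFin \o (fun w => (pivotal (c w))%:R)).
  exact: integrable_bool (mc pivotal).
have i2 : P.-integrable setT (EFin \o (fun w =>
    (\sum_(i < l) X i w) * (pivotal (c w))%:R * \1_`]t, +oo[ (G w))).
  exact: (integrableM_bool P _ (fun w => G w \in `]t, +oo[%classic) iE (mG1 t)).
have i3 : P.-integrable setT (EFin \o (fun w =>
    (pivotal (c w))%:R * (G w * \1_`]t, +oo[ (G w)))).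
  have := integrableM_bool P _ (fun w => pivotal (c w)) (iGG1 t) (mc pivotal).
  by apply: eq_integrable => // w _; rewrite /= mulrC.
have i3' : P.-integrable setT (EFin \o (fun w => (n - l)%:R *
    ((pivotal (c w))%:R * (G w * \1_`]t, +oo[ (G w))))).
  by have := integrableZl measurableT (n - l)%:R i3.
have i12 := integrableD measurableT i1 i2.
have i123 := integrableD measurableT i12 i3'.
have g0 : (n - l)%:R != 0 :> R by rewrite pnatr_eq0 subn_eq0 -ltnNge.
rewrite /society_increment unlock.
(* Only where the group is decisive is the total split into the egoists' sum and (n - l) G; the part
   carried by the egoists alone keeps the whole sum. *)
have -> : (fun w => ((\sum_(i < n) X i w) *
      (accepted n l alpha t (fun i => X i w))%:R)%:E) =
    (EFin \o (fun w => (\sum_(i < n) X i w) * (passes (c w))%:R +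
      (\sum_(i < l) X i w) * (pivotal (c w))%:R * \1_`]t, +oo[ (G w) +
      (n - l)%:R * ((pivotal (c w))%:R * (G w * \1_`]t, +oo[ (G w))))).
  apply/funext => w /=; congr EFin; rewrite acceptedE.
  have -> : \sum_(i < n) X i w = \sum_(i < l) X i w + (n - l)%:R * G w.
    rewrite /G mulrC divfK// -!(big_mkord xpredT (fun i => X i w)).
    by rewrite (big_cat_nat (n := l))//= ltnW.
  by ring.
rewrite -[LHS]fineK; last exact: integrable_fin_num.
congr EFin; rewrite -/(Rintegral P setT _).
rewrite RintegralD// RintegralD// RintegralZl//.
congr (_ + _ + _ * _).
  exact: (block_RintegralM P X n K _ _ ind begoist (bG1 t) iE (iG1 t)).
exact: (block_RintegralM P X n K _ _ ind bpivotal (measurable_funM bG (bG1 t)) ip (iGG1 t)).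
Qed.

Lemma pivotal_probE : pivotal_prob = binom_mean (Phi (m / s)) l pivotal.
Proof. exact/(Rintegral_count_pos P X n m s s0 iid)/ltnW. Qed.

Lemma egoist_meanE :
  egoist_mean = l%:R * normal_pos_count_mean m s l.-1 pivotal.
Proof.
have E w : (\sum_(i < l) X i w) * (pivotal (c w))%:R =
    \sum_(i <- index_iota 0 l) X i w * (pivotal (c w))%:R.
  by rewrite -mulr_suml big_mkord.
rewrite /egoist_mean; under eq_Rintegral do rewrite E.
rewrite Rintegral_sum.
  rewrite big_seq_cond (eq_bigr (fun=> normal_pos_count_mean m s l.-1 pivotal)).
    by rewrite -big_seq_cond big_const_nat subn0 iter_addr_0 mulr_natl.
  move=> i; rewrite mem_index_iota andbT => il.
  exact: (RintegralM_count_pos P X n m s s0 iid i l pivotal il (ltnW ln)).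
move=> i; rewrite mem_index_iota => /= il.
apply: (integrableM_bool P (X i)); last exact: mc.
exact/iX/(ltn_trans il).
Qed.

Lemma egoist_mean_eq0 : pivotal_prob = 0 -> egoist_mean = 0.
Proof. by apply: Rintegral_bool_eq0; [exact/isum/ltnW|exact: mc]. Qed.

(** The condition on [t0] is stated without division, so that it also covers [pivotal_prob = 0]. *)
Lemma society_increment_max t0 t :
  (n - l)%:R * (pivotal_prob * t0) = - egoist_mean ->
  (society_increment P n l X alpha t <= society_increment P n l X alpha t0)%E.
Proof.
move=> et0; have eE : egoist_mean = - ((n - l)%:R * (pivotal_prob * t0)).
  by rewrite et0 opprK.
rewrite !society_incrementE lee_fin -!addrA lerD2l.
have iB u : P.-integrable setT (EFin \o (fun w => (G w - t0) * \1_`]u, +oo[ (G w))).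
  apply: (integrableM_bool P _ (fun w => G w \in `]u, +oo[%classic) _ (mG1 u)).
  have := integrableB measurableT iG (finite_measure_integrable_cst P t0 measurableT).
  exact: eq_integrable.
have E u : egoist_mean * (\int[P]_w \1_`]u, +oo[ (G w)) +
    (n - l)%:R * (pivotal_prob * \int[P]_w (G w * \1_`]u, +oo[ (G w))) =
    (n - l)%:R * (pivotal_prob * \int[P]_w ((G w - t0) * \1_`]u, +oo[ (G w))).
  under [in RHS]eq_Rintegral do rewrite mulrBl.
  rewrite RintegralB//; last by have := integrableZl measurableT t0 (iG1 u).
  by rewrite RintegralZl// eE; ring.
rewrite !E ler_wpM2l// ler_wpM2l//.
  by apply: Rintegral_ge0 => w _.
apply: le_Rintegral => // w _.
(* The two indicators differ only if t < G <= t0, where G - t0 <= 0 is counted on the left alone, or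
   t0 < G <= t, where G - t0 > 0 is counted on the right alone. *)
rewrite !indicE !mem_setE !in_itv/= !andbT.
by case: (ltP t); case: (ltP t0) => h1 h2;
  rewrite ?mulr1 ?mulr0 ?subr_ge0 ?subr_le0// ltW.
Qed.

End society.

Theorem mainTheorem3 (R : realType)
  (d : measure_display) (T : measurableType d) (P : probability T R)
  (d' : measure_display) (T' : measurableType d') (Q : probability T' R)
  (n l : nat) (mu sigma alpha : R)
  (zeta : nat -> {RV P >-> R}) (xi : nat -> {RV Q >-> R}) :
  (1 <= l)%N -> (l <= n - 1)%N -> 0 < sigma -> 0 <= alpha -> alpha < 1 ->
  iid_normal P n zeta mu sigma ->
  iid_normal Q l xi mu sigma ->
  let delta := l%:R / n%:R in
  let gamma := alpha + delta - 1 in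
  let beta := l%:R / (n - l)%:R in
  let t0 := beta / (F_xi mu sigma l (gamma * n%:R) - F_xi mu sigma l (alpha * n%:R))
            * (fine (mu_plus Q l xi (alpha * n%:R)) - fine (mu_plus Q l xi (gamma * n%:R))) in
  forall t : R,
    (society_increment P n l zeta alpha t <= society_increment P n l zeta alpha t0)%E.
Proof.
move=> l1 ln s0 _ _ iidP iidQ delta gamma beta t0 t.
have l_lt_n : (l < n)%N by lia.
have n0 : n%:R != 0 :> R by rewrite pnatr_eq0; lia.
have g0 : (n - l)%:R != 0 :> R by rewrite pnatr_eq0; lia.
(* The threshold gamma n is what the egoists must exceed once the n - l votes of the group are cast
   in favour. *)
have gammaE : gamma * n%:R = alpha * n%:R - (n - l)%:R.
  by rewrite /gamma /delta natrB ?(ltnW l_lt_n)//; field.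
have sub x : alpha * n%:R < x%:R -> gamma * n%:R < x%:R.
  by apply: le_lt_trans; rewrite gammaE gerBl.
apply: (society_increment_max P n l mu sigma alpha zeta s0 l_lt_n iidP).
(* If the group is decisive with probability zero, both sides of the condition vanish, whatever
   value the quotient defining [t0] takes. *)
have [a0|a0] := eqVneq (pivotal_prob P n l alpha zeta) 0.
  by rewrite (egoist_mean_eq0 P n l mu sigma alpha zeta s0 l_lt_n iidP a0) a0 mul0r mulr0 oppr0.
rewrite (egoist_meanE P n l mu sigma alpha zeta s0 l_lt_n iidP).
rewrite /t0 !F_xiE (mu_plusE Q xi l mu sigma)// (mu_plusE Q xi l mu sigma)//.
(* The difference of mu^+ is reversed, because gamma n is the lower threshold and its event contains
   the other; this is the source of the minus sign in the condition on [t0]. *)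
rewrite binom_mean_diff// -opprB normal_pos_count_mean_diff// gammaE.
rewrite -(pivotal_probE P n l mu sigma alpha zeta s0 l_lt_n iidP) /beta.
by field; rewrite a0 g0.
Qed.
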